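(* Each of the following five $4$-dimensional symplectic Lie algebras $(\mathfrak g,\omega)$ (given in a basis $\{e_1,\dots,e_4\}$ with dual basis $\{e^i\}$, listing only the nonzero brackets) admits an inner product $g$ compatible with $\omega$ such that $(\omega,g)$ is a SCF-soliton: (1) $\mathbb{R}^4$: abelian, $\omega=e^1\wedge e^2+e^3\wedge e^4$; (2) $\mathfrak{rh}_3$: $[e_1,e_2]=e_3$, $\omega=e^1\wedge e^4+e^2\wedge e^3$; (3) $\mathfrak{rr}_{3,-1}$: $[e_1,e_2]=e_2$, $[e_1,e_3]=-e_3$, $\omega=e^1\wedge e^4+e^2\wedge e^3$; (4) $\mathfrak{rr}'_{3,0}$: $[e_1,e_3]=e_2$, $[e_1,e_2]=-e_3$, $\omega=e^1\wedge e^4+e^2\wedge e^3$; (5) $\mathfrak n_4$: $[e_4,e_1]=e_2$, $[e_4,e_2]=e_3$, $\omega=e^1\wedge e^2+e^3\wedge e^4$. The soliton is steady in the (flat) cases $\mathbb{R}^4$ and $\mathfrak{rr}'_{3,0}$, and expanding in the other three cases.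
   Context: A symplectic Lie algebra $(\mathfrak g,\omega)$ is a Lie algebra with a non-degenerate closed 2-form, i.e. $\omega([X,Y],Z)+\omega([Y,Z],X)+\omega([Z,X],Y)=0$. An inner product $g$ on $\mathfrak g$ is compatible with $\omega$ if $J$ defined by $\omega=g(J\cdot,\cdot)$ satisfies $J^2=-I$; then $(\omega,g)$ is an almost-Kähler structure (left-invariant on the corresponding Lie group). The Chern-Ricci form is $p(X,Y)=-\frac12\operatorname{tr}(J\operatorname{ad}[X,Y])+\frac12\operatorname{tr}(\operatorname{ad}J[X,Y])$, and the Chern-Ricci operator $P$ is defined by $p=\omega(P\cdot,\cdot)$. $\mathrm{Ric}$ is the Ricci operator of the left-invariant metric $g$. For $E\in\operatorname{End}(\mathfrak g)$: $E^{c}=\frac12(E-JEJ)$, $E^{ac}=\frac12(E+JEJ)$. $(\omega,g)$ is a SCF-soliton if for some $c\in\mathbb{R}$ and $D\in\operatorname{Der}(\mathfrak g)$, $$P=cI+\tfrac12(D-JD^tJ),\qquad P^{c}+\mathrm{Ric}^{ac}=cI+\tfrac12(D+D^t);$$ it is expanding, steady or shrinking if $c<0$, $c=0$ or $c>0$, respectively (in the flat cases, steady means the condition holds with $c=0$). *)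

(* Defs.v *)
From HB Require Import structures.
From mathcomp Require Import all_boot all_order all_algebra.
From mathcomp Require Import reals ring.

Set Implicit Arguments.
Unset Strict Implicit.
Unset Printing Implicit Defensive.

Import Order.TTheory GRing.Theory Num.Theory.
Local Open Scope ring_scope.

(* The underlying vector space of an n-dimensional Lie algebra is 'rV[R]_n.
   Following MathComp, an endomorphism is a matrix acting on row vectors on the
   right: [X *m E] is E(X), and the composite "E after F" is [F *m E]. *)

Section AlmostKaehler.
Variables (R : realType) (n : nat).
Local Notation V := 'rV[R]_n.

Implicit Types (br : V -> V -> V) (om g a b : V -> V -> R) (D E J : 'M[R]_n).

Record lie_bracket br : Prop := LieBracket {
  lie_bilinear : bilinear_for *:%R *:%R br;
  lie_alternating : forall X, br X X = 0;
  lie_jacobi : forall X Y Z,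
    br (br X Y) Z + br (br Y Z) X + br (br Z X) Y = 0 }.

Definition nondegenerate_form a := forall X, (forall Y, a X Y = 0) -> X = 0.

Record symplectic_lie_algebra br om : Prop := SymplecticLieAlgebra {
  symplectic_lie : lie_bracket br;
  symplectic_bilinear : bilinear_for *%R *%R om;
  symplectic_alternating : forall X, om X X = 0;
  symplectic_nondegenerate : nondegenerate_form om;
  symplectic_closed : forall X Y Z,
    om (br X Y) Z + om (br Y Z) X + om (br Z X) Y = 0 }.

Record inner_product g : Prop := InnerProduct {
  inner_bilinear : bilinear_for *%R *%R g;
  inner_sym : forall X Y, g X Y = g Y X;
  inner_pos : forall X, X != 0 -> 0 < g X X }.

Definition gram a : 'M[R]_n := \matrix_(i, j) a (delta_mx 0 i) (delta_mx 0 j).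

(* The operator E such that b = a(E . , .), for a non-degenerate;
   see operator_ofP. *)
Definition operator_of a b : 'M[R]_n := gram b *m invmx (gram a).

(* The transpose with respect to g: g(E^t X, Y) = g(X, E Y). *)
Definition adjoint g E : 'M[R]_n := operator_of g (fun X Y => g X (Y *m E)).

Definition ad br X : 'M[R]_n := lin1_mx (br X).

Definition derivation br D :=
  forall X Y, br X Y *m D = br (X *m D) Y + br X (Y *m D).

Definition complex_part J E : 'M[R]_n := 2^-1 *: (E - J *m E *m J).
Definition anticomplex_part J E : 'M[R]_n := 2^-1 *: (E + J *m E *m J).

(* The J defined by om = g(J . , .); see acsP. *)
Definition acs om g : 'M[R]_n := operator_of g om.

Definition compatible om g := acs om g *m acs om g = - 1%:M.

Definition almost_kaehler om g := inner_product g /\ compatible om g.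

Definition chern_ricci_form br J X Y : R :=
  - (2^-1 * \tr (ad br (br X Y) *m J)) + 2^-1 * \tr (ad br (br X Y *m J)).

Definition chern_ricci br om g : 'M[R]_n :=
  operator_of om (chern_ricci_form br (acs om g)).

(* The Levi-Civita connection of the left-invariant metric g, on left-invariant
   vector fields, by the Koszul formula; see nabla_torsion_free and
   nabla_metric. *)
Definition koszul br g X Y Z : R :=
  2^-1 * (g (br X Y) Z - g (br Y Z) X + g (br Z X) Y).

Definition nabla br g X Y : V := Y *m operator_of g (koszul br g X).

Definition curvature br g X Y Z : V :=
  nabla br g X (nabla br g Y Z) - nabla br g Y (nabla br g X Z)
  - nabla br g (br X Y) Z.

Definition flat br g := forall X Y Z, curvature br g X Y Z = 0.

Definition ricci_form br g Y Z : R :=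
  \tr (lin1_mx (fun X => curvature br g X Y Z)).

Definition ricci br g : 'M[R]_n := operator_of g (ricci_form br g).

Definition scf_equations br om g (c : R) D :=
  let J := acs om g in
  let P := chern_ricci br om g in
  let Dt := adjoint g D in
  P = c%:M + 2^-1 *: (D - J *m Dt *m J) /\
  complex_part J P + anticomplex_part J (ricci br g)
    = c%:M + 2^-1 *: (D + Dt).

Definition scf_soliton_const br om g (c : R) :=
  exists D, derivation br D /\ scf_equations br om g c D.

Definition steady_scf_soliton br om g := scf_soliton_const br om g 0.

Definition expanding_scf_soliton br om g :=
  exists c, c < 0 /\ scf_soliton_const br om g c.

Lemma bilinear_gram a X Y :
  bilinear_for *%R *%R a -> a X Y = (X *m gram a *m Y^T) 0 0.
Proof.
move=> [aL aR].
have a0l Z : a 0 Z = 0.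
  by have := aL Z (-1) 0 0; rewrite /= scaler0 addr0 mulN1r addNr.
have a0r Z : a Z 0 = 0.
  by have := aR Z (-1) 0 0; rewrite /= scaler0 addr0 mulN1r addNr.
have suml Z (f : 'I_n -> V) (c : 'I_n -> R) :
    a (\sum_i c i *: f i) Z = \sum_i c i * a (f i) Z.
  elim/big_rec2: _ => [|i u v _ <-]; first by rewrite a0l.
  by have /= -> := aL Z.
have sumr Z (f : 'I_n -> V) (c : 'I_n -> R) :
    a Z (\sum_i c i *: f i) = \sum_i c i * a Z (f i).
  elim/big_rec2: _ => [|i u v _ <-]; first by rewrite a0r.
  by have /= -> := aR Z.
rewrite {1}(row_sum_delta X) {1}(row_sum_delta Y) sumr mxE.
apply: eq_bigr => j _; rewrite suml !mxE mulrC; congr (_ * _).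
by apply: eq_bigr => i _; rewrite mxE.
Qed.

Lemma gram_unit a :
  bilinear_for *%R *%R a -> nondegenerate_form a -> gram a \in unitmx.
Proof.
move=> aB aN; rewrite -row_free_unit; apply/inj_row_free => X X0.
by apply: aN => Y; rewrite (bilinear_gram _ _ aB) X0 mul0mx mxE.
Qed.

Lemma operator_ofP a b X Y :
    bilinear_for *%R *%R a -> nondegenerate_form a ->
    bilinear_for *%R *%R b ->
  a (X *m operator_of a b) Y = b X Y.
Proof.
move=> aB aN bB; rewrite (bilinear_gram _ _ aB) (bilinear_gram _ _ bB).
by rewrite /operator_of mulmxA mulmxKV // gram_unit.
Qed.

Lemma inner_nondegenerate g : inner_product g -> nondegenerate_form g.
Proof.
move=> gI X X0; apply/eqP; apply: contraT => /(inner_pos gI).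
by rewrite X0 ltxx.
Qed.

Lemma adjointP g E X Y :
  inner_product g -> g (X *m adjoint g E) Y = g X (Y *m E).
Proof.
move=> gI; have [gL gR] := inner_bilinear gI.
apply: operator_ofP (inner_bilinear gI) (inner_nondegenerate gI) _.
split=> Z u v w /=; first exact: gL.
by rewrite mulmxDl -scalemxAl gR.
Qed.

Lemma lieDl br (bL : lie_bracket br) c X Y Z :
  br (c *: X + Y) Z = c *: br X Z + br Y Z.
Proof. by case: bL => [[bl _] _ _]; exact: bl. Qed.

Lemma lieDr br (bL : lie_bracket br) c X Y Z :
  br Z (c *: X + Y) = c *: br Z X + br Z Y.
Proof. by case: bL => [[_ br'] _ _]; exact: br'. Qed.

Lemma lieC br (bL : lie_bracket br) X Y : br X Y = - br Y X.
Proof.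
apply/eqP; rewrite -addr_eq0; apply/eqP.
have := lie_alternating bL (1 *: X + Y).
by rewrite (lieDl bL) !(lieDr bL) !(lie_alternating bL) !scale1r addr0 add0r.
Qed.

Lemma innerDl g (gI : inner_product g) c X Y Z :
  g (c *: X + Y) Z = c * g X Z + g Y Z.
Proof. by case: gI => [[gl _] _ _]; exact: gl. Qed.

Lemma innerDr g (gI : inner_product g) c X Y Z :
  g Z (c *: X + Y) = c * g Z X + g Z Y.
Proof. by case: gI => [[_ gr] _ _]; exact: gr. Qed.

Lemma innerN g (gI : inner_product g) X Y : g (- X) Y = - g X Y.
Proof.
have g0 : g 0 Y = 0.
  by have := innerDl gI (-1) 0 0 Y; rewrite scaler0 addr0 mulN1r addNr.
by rewrite -scaleN1r -[_ *: _]addr0 (innerDl gI) g0 mulN1r addr0.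
Qed.

Lemma innerD g (gI : inner_product g) X Y Z : g (X + Y) Z = g X Z + g Y Z.
Proof. by rewrite -[X in X + _]scale1r (innerDl gI) mul1r. Qed.

Lemma nablaP br g X Y Z : lie_bracket br -> inner_product g ->
  g (nabla br g X Y) Z = koszul br g X Y Z.
Proof.
move=> bL gI.
apply: operator_ofP (inner_bilinear gI) (inner_nondegenerate gI) _.
by split=> W c u v; rewrite /koszul /= !(lieDl bL) !(lieDr bL) !(innerDl gI)
  !(innerDr gI); ring.
Qed.

Lemma nabla_torsion_free br g X Y : lie_bracket br -> inner_product g ->
  nabla br g X Y - nabla br g Y X = br X Y.
Proof.
move=> bL gI; apply/eqP; rewrite -subr_eq0; apply/eqP.
apply: (inner_nondegenerate gI) => Z.
rewrite !(innerD gI) !(innerN gI) !nablaP // /koszul.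
rewrite (lieC bL Y X) (lieC bL X Z) (lieC bL Y Z) !(innerN gI).
by field.
Qed.

Lemma nabla_metric br g X Y Z : lie_bracket br -> inner_product g ->
  g (nabla br g X Y) Z + g Y (nabla br g X Z) = 0.
Proof.
move=> bL gI; rewrite (inner_sym gI Y) !nablaP // /koszul.
rewrite (lieC bL Z Y) (lieC bL Z X) (lieC bL Y X) !(innerN gI).
by field.
Qed.

Lemma acsP br om g X Y : symplectic_lie_algebra br om -> inner_product g ->
  g (X *m acs om g) Y = om X Y.
Proof.
move=> omS gI; apply: operator_ofP (symplectic_bilinear omS).
  exact: inner_bilinear.
exact: inner_nondegenerate.
Qed.

Lemma adD br (bL : lie_bracket br) c X Y :
  ad br (c *: X + Y) = c *: ad br X + ad br Y.
Proof. by apply/matrixP => i j; rewrite !mxE (lieDl bL) !mxE. Qed.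

Lemma chern_ricciP br om g X Y : symplectic_lie_algebra br om ->
  om (X *m chern_ricci br om g) Y = chern_ricci_form br (acs om g) X Y.
Proof.
move=> omS; have bL := symplectic_lie omS.
apply: operator_ofP (symplectic_bilinear omS) (symplectic_nondegenerate omS) _.
by split=> W c u v; rewrite /chern_ricci_form /= ?(lieDl bL) ?(lieDr bL)
  mulmxDl -scalemxAl !(adD bL) mulmxDl -scalemxAl !mxtraceD !mxtraceZ; ring.
Qed.

Lemma nablaDl br g (bL : lie_bracket br) (gI : inner_product g) c X Y Z :
  nabla br g (c *: X + Y) Z = c *: nabla br g X Z + nabla br g Y Z.
Proof.
apply/eqP; rewrite -subr_eq0; apply/eqP.
apply: (inner_nondegenerate gI) => W.
rewrite (innerD gI) (innerN gI) (innerDl gI) !nablaP // /koszul.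
by rewrite !(lieDl bL) !(lieDr bL) !(innerDl gI) !(innerDr gI); ring.
Qed.

Lemma nablaDr br g c X Y Z :
  nabla br g X (c *: Y + Z) = c *: nabla br g X Y + nabla br g X Z.
Proof. by rewrite /nabla mulmxDl scalemxAl. Qed.

Lemma scale_subD c (a a' b b' d d' : V) :
  (c *: a + a') - (c *: b + b') - (c *: d + d')
  = c *: (a - b - d) + (a' - b' - d').
Proof. by apply/rowP => k; rewrite !mxE; ring. Qed.

Lemma curvatureDm br g (bL : lie_bracket br) (gI : inner_product g) c X Y Z W :
  curvature br g X (c *: Y + Z) W =
  c *: curvature br g X Y W + curvature br g X Z W.
Proof.
rewrite /curvature (lieDr bL) !(nablaDl bL gI) !nablaDr.
exact: scale_subD.
Qed.

Lemma curvatureDr br g c X Y Z W :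
  curvature br g X Y (c *: Z + W) =
  c *: curvature br g X Y Z + curvature br g X Y W.
Proof.
rewrite /curvature !nablaDr.
exact: scale_subD.
Qed.

Lemma ricciP br g X Y : lie_bracket br -> inner_product g ->
  g (X *m ricci br g) Y = ricci_form br g X Y.
Proof.
move=> bL gI.
apply: operator_ofP (inner_bilinear gI) (inner_nondegenerate gI) _.
split=> W c u v; rewrite /ricci_form /= -mxtraceZ -mxtraceD; congr (\tr _);
  apply/matrixP => i k; rewrite [LHS]mxE.
  by rewrite (curvatureDm bL gI) !mxE.
by rewrite curvatureDr !mxE.
Qed.

End AlmostKaehler.

Section Examples.
Variable R : realType.
Local Notation V := 'rV[R]_4.
Implicit Types X Y : V.

(* Basis vectors e_1, ..., e_4 and the 2-forms e^i /\ e^j are numbered from 1. *)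
Definition idx (i : nat) : 'I_4 := inord i.-1.
Definition e (i : nat) : V := delta_mx 0 (idx i).
Definition wedge (i j : nat) X Y : R :=
  X 0 (idx i) * Y 0 (idx j) - X 0 (idx j) * Y 0 (idx i).

(* The summand [wedge i j X Y *: v] of a bracket encodes [e_i, e_j] = v. *)
Definition om_12_34 X Y : R := wedge 1 2 X Y + wedge 3 4 X Y.
Definition om_14_23 X Y : R := wedge 1 4 X Y + wedge 2 3 X Y.

Definition br_R4 X Y : V := 0.
Definition br_rh3 X Y : V := wedge 1 2 X Y *: e 3.
Definition br_rr3m1 X Y : V := wedge 1 2 X Y *: e 2 + wedge 1 3 X Y *: - e 3.
Definition br_rr30' X Y : V := wedge 1 3 X Y *: e 2 + wedge 1 2 X Y *: - e 3.
Definition br_n4 X Y : V := wedge 4 1 X Y *: e 2 + wedge 4 2 X Y *: e 3.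

End Examples.

(* Main.v *)
Require Import Defs.
From mathcomp Require Import all_boot all_order all_algebra.
From mathcomp Require Import reals.
From mathcomp Require Import ring.

Set Implicit Arguments.
Unset Strict Implicit.
Unset Printing Implicit Defensive.

Import Order.TTheory GRing.Theory Num.Theory.
Local Open Scope ring_scope.

(* In all five cases the metric making e_1, ..., e_4 orthonormal works.  It turns
   the Koszul formula into a closed form for the connection, so P and Ric become
   explicit rational matrices, and the two soliton equations together with the
   derivation identity form a linear system in (D, c).  Solving it gives c = 0
   for the two flat algebras, c = -1 for rr_{3,-1}, and c = -5/4 for rh_3 and
   n_4; P vanishes except for n_4, where D is not diagonal. *)

(** * Uniqueness of represented operators, and the standard inner product *)

Section Generalities.
Variables (R : realType) (n : nat).
Local Notation V := 'rV[R]_n.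
Implicit Types (br : V -> V -> V) (a b g om : V -> V -> R) (A B D M : 'M[R]_n).

Lemma eq_mulmx_row A B : (forall X : V, X *m A = X *m B) -> A = B.
Proof. by move=> eqAB; apply/row_matrixP => i; rewrite !rowE eqAB. Qed.

(** Evaluating on basis vectors gives [gram b = M *m gram a], and non-degeneracy lets [gram a] be
    cancelled. Every operator below is thus found by exhibiting a candidate, never by inverting a
    Gram matrix. *)
Lemma operator_of_unique a b M :
    bilinear_for *%R *%R a -> nondegenerate_form a ->
    (forall X Y, b X Y = a (X *m M) Y) ->
  operator_of a b = M.
Proof.
move=> aB aN bE; rewrite /operator_of.
suff -> : gram b = M *m gram a by rewrite mulmxK // gram_unit.
apply/matrixP => i j; rewrite [LHS]mxE bE (bilinear_gram _ _ aB).
by rewrite trmx_delta -colE mxE -[_ *m M *m _]mulmxA -rowE mxE.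
Qed.

(** Pairing with all [Z] determines a vector, so a proposed closed form for the connection only has
    to be tested against the Koszul expression. *)
Lemma nabla_unique br g X Y W : lie_bracket br -> inner_product g ->
  (forall Z, koszul br g X Y Z = g W Z) -> nabla br g X Y = W.
Proof.
move=> bL gI gW; apply/eqP; rewrite -subr_eq0; apply/eqP.
apply: (inner_nondegenerate gI) => Z.
by rewrite (innerD gI) (innerN gI) nablaP // gW subrr.
Qed.

Lemma lie_bracket_intro br :
    (forall c (X Y Z : V), br (c *: X + Y) Z = c *: br X Z + br Y Z) ->
    (forall c (X Y Z : V), br Z (c *: X + Y) = c *: br Z X + br Z Y) ->
    (forall X, br X X = 0) ->
    (forall X Y Z, br (br X Y) Z + br (br Y Z) X + br (br Z X) Y = 0) ->
  lie_bracket br.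
Proof. by move=> brl brr brX brJ; split=> //; split=> Z c X Y /=. Qed.

Definition dot (X Y : V) : R := \sum_i X 0 i * Y 0 i.

Lemma dotE X Y : dot X Y = (X *m Y^T) 0 0.
Proof. by rewrite mxE; apply: eq_bigr => i _; rewrite mxE. Qed.

Lemma dot_inner_product : inner_product dot.
Proof.
split=> [|X Y|X X0].
- split=> Z c X Y; rewrite /= !dotE.
    by rewrite mulmxDl -scalemxAl !mxE.
  by rewrite linearP /= mulmxDr -scalemxAr !mxE.
- by apply: eq_bigr => i _; rewrite mulrC.
- rewrite lt_def sumr_ge0 ?andbT => [|i _]; last exact: sqr_ge0.
  apply: contraNneq X0 => /psumr_eq0P X0; apply/eqP/rowP => i; rewrite mxE.
  apply/eqP; rewrite -sqrf_eq0 expr2 X0 // => j _; exact: sqr_ge0.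
Qed.

Lemma adjoint_dot D : adjoint dot D = D^T.
Proof.
apply: operator_of_unique => [||X Y].
- exact: inner_bilinear dot_inner_product.
- exact: inner_nondegenerate dot_inner_product.
by rewrite !dotE trmx_mul mulmxA.
Qed.

End Generalities.

Arguments dot {R n}.

(** * Almost-Kähler structures whose metric is the standard inner product *)

Section DotKaehler.
Variables (R : realType) (n : nat) (om : 'rV[R]_n -> 'rV[R]_n -> R) (J : 'M[R]_n).
Hypotheses (omE : forall X Y, om X Y = dot (X *m J) Y) (sqrJ : J *m J = - 1%:M).

Lemma dot_form_bilinear : bilinear_for *%R *%R om.
Proof.
have [dotl dotr] := inner_bilinear (dot_inner_product R n).
split=> Z c X Y; rewrite /= !omE ?mulmxDl -?scalemxAl; first exact: dotl.
exact: dotr.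
Qed.

Lemma dot_form_nondegenerate : nondegenerate_form om.
Proof.
move=> X X0; have XJ0 : X *m J = 0.
  by apply: (inner_nondegenerate (dot_inner_product R n)) => Y; rewrite -omE.
(* Here [- X] is rewritten as [X *m J *m J], which vanishes with [X *m J]. *)
by apply: oppr_inj; rewrite oppr0 -[in LHS](mulmx1 X) -mulmxN -sqrJ mulmxA XJ0
  mul0mx.
Qed.

Lemma acs_dot : acs om dot = J.
Proof.
apply: operator_of_unique => //.
- exact: inner_bilinear (dot_inner_product R n).
- exact: inner_nondegenerate (dot_inner_product R n).
Qed.

Lemma almost_kaehler_dot : almost_kaehler om dot.
Proof. by split; [exact: dot_inner_product | rewrite /compatible acs_dot]. Qed.

(** Uniqueness replaces the Chern-Ricci and Ricci operators by the candidates [P] and [Ric], and the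
    adjoint becomes the transpose. What remains are identities between explicit matrices. *)
Lemma scf_soliton_dot (br : 'rV[R]_n -> 'rV[R]_n -> 'rV[R]_n) c (P Ric D : 'M_n) :
    (forall X Y, chern_ricci_form br J X Y = om (X *m P) Y) ->
    (forall X Y, ricci_form br dot X Y = dot (X *m Ric) Y) ->
    derivation br D ->
    P = c%:M + 2^-1 *: (D - J *m D^T *m J) ->
    complex_part J P + anticomplex_part J Ric = c%:M + 2^-1 *: (D + D^T) ->
  scf_soliton_const br om dot c.
Proof.
move=> cfP ricP derD PE RicE; exists D; split=> //.
rewrite /scf_equations acs_dot adjoint_dot /chern_ricci acs_dot.
rewrite (operator_of_unique dot_form_bilinear dot_form_nondegenerate cfP).
rewrite /ricci (operator_of_unique _ _ ricP) //.
- exact: inner_bilinear (dot_inner_product R n).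
- exact: inner_nondegenerate (dot_inner_product R n).
Qed.

End DotKaehler.

(** * Coordinate calculus in dimension 4 *)

Section Dimension4.
Variable R : realType.
Local Notation V := 'rV[R]_4.
Implicit Types (X Y : V) (a b c d x y z t : R).

(** Normal form for vectors: sums, multiples and matrix images of [row4] terms reduce to [row4]
    terms, so a vector identity splits into four scalar ones. *)
Definition row4 a b c d : V := \row_j [:: a; b; c; d]`_j.

Definition mx4 (A B C D : V) : 'M[R]_4 := \matrix_i [:: A; B; C; D]`_i.

Lemma sum_idx (U : nmodType) (F : 'I_4 -> U) :
  \sum_i F i = F (idx 1) + F (idx 2) + F (idx 3) + F (idx 4).
Proof.
rewrite !big_ord_recr big_ord0 /= add0r.
by do !congr (_ + _); congr F; apply: val_inj; rewrite /= inordK.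
Qed.

Lemma row4_idx a b c d :
  (row4 a b c d 0 (idx 1) = a) * (row4 a b c d 0 (idx 2) = b) *
  (row4 a b c d 0 (idx 3) = c) * (row4 a b c d 0 (idx 4) = d).
Proof. by split; [split; [split|]|]; rewrite mxE inordK. Qed.

Lemma row4P X :
  X = row4 (X 0 (idx 1)) (X 0 (idx 2)) (X 0 (idx 3)) (X 0 (idx 4)).
Proof.
apply/rowP => -[[|[|[|[|//]]]] i_lt]; rewrite !mxE /=;
  by congr (X 0 _); apply: val_inj; rewrite /= inordK.
Qed.

Lemma row4D a b c d x y z t :
  row4 a b c d + row4 x y z t = row4 (a + x) (b + y) (c + z) (d + t).
Proof. by apply/rowP => -[[|[|[|[|//]]]] ?]; rewrite !mxE. Qed.

Lemma row4N a b c d : - row4 a b c d = row4 (- a) (- b) (- c) (- d).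
Proof. by apply/rowP => -[[|[|[|[|//]]]] ?]; rewrite !mxE. Qed.

Lemma row4Z k a b c d :
  k *: row4 a b c d = row4 (k * a) (k * b) (k * c) (k * d).
Proof. by apply/rowP => -[[|[|[|[|//]]]] ?]; rewrite !mxE. Qed.

Lemma row4_0 : 0 = row4 0 0 0 0.
Proof. by apply/rowP => -[[|[|[|[|//]]]] ?]; rewrite !mxE. Qed.

Lemma e_row4 :
  (e R 1 = row4 1 0 0 0) * (e R 2 = row4 0 1 0 0) *
  (e R 3 = row4 0 0 1 0) * (e R 4 = row4 0 0 0 1).
Proof.
by split; [split; [split|]|]; apply/rowP => -[[|[|[|[|//]]]] ?];
  rewrite !mxE -!val_eqE /= inordK.
Qed.

Lemma mul_row4_mx4 a b c d (A B C D : V) :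
  row4 a b c d *m mx4 A B C D = a *: A + b *: B + c *: C + d *: D.
Proof.
rewrite mulmx_sum_row sum_idx !row4_idx.
by do !congr (_ + _); rewrite rowK inordK.
Qed.

Lemma tr_mx4 a1 a2 a3 a4 b1 b2 b3 b4 c1 c2 c3 c4 d1 d2 d3 d4 :
  (mx4 (row4 a1 a2 a3 a4) (row4 b1 b2 b3 b4)
       (row4 c1 c2 c3 c4) (row4 d1 d2 d3 d4))^T =
  mx4 (row4 a1 b1 c1 d1) (row4 a2 b2 c2 d2)
      (row4 a3 b3 c3 d3) (row4 a4 b4 c4 d4).
Proof.
apply/matrixP => -[[|[|[|[|//]]]] ?] [[|[|[|[|//]]]] ?];
  by rewrite !mxE /= ?mxE.
Qed.

Lemma dot_row4 a b c d x y z t :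
  dot (row4 a b c d) (row4 x y z t) = a * x + b * y + c * z + d * t.
Proof. by rewrite /dot sum_idx !row4_idx. Qed.

(** Traces reduce to values of [f] on basis vectors in [row4] form, where the coordinate formulas
    for brackets and connections apply directly. *)
Lemma trace_lin1_mx (f : V -> V) :
  \tr (lin1_mx f) =
  f (row4 1 0 0 0) 0 (idx 1) + f (row4 0 1 0 0) 0 (idx 2)
  + f (row4 0 0 1 0) 0 (idx 3) + f (row4 0 0 0 1) 0 (idx 4).
Proof. by rewrite /mxtrace sum_idx -!e_row4 !mxE. Qed.

Lemma trace_ad_mul (br : V -> V -> V) X (M : 'M[R]_4) :
  \tr (ad br X *m M) = \tr (lin1_mx (fun Y => br X Y *m M)).
Proof.
congr (\tr _); apply/row_matrixP => i; rewrite row_mul /ad.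
suff row_lin1 f : row i (lin1_mx f) = f (delta_mx 0 i) :> V by rewrite !row_lin1.
by apply/rowP => j; rewrite !mxE.
Qed.

Lemma row4_ind (P : V -> Prop) :
  (forall a b c d, P (row4 a b c d)) -> forall X, P X.
Proof. by move=> PV X; rewrite (row4P X). Qed.

Definition row4E := (row4D, row4N, row4Z, mul_row4_mx4, dot_row4).

(** * The two complex structures; row i holds the image of e_i *)

Definition J12_34 : 'M[R]_4 :=
  mx4 (row4 0 1 0 0) (row4 (-1) 0 0 0) (row4 0 0 0 1) (row4 0 0 (-1) 0).

Definition J14_23 : 'M[R]_4 :=
  mx4 (row4 0 0 0 1) (row4 0 0 1 0) (row4 0 (-1) 0 0) (row4 (-1) 0 0 0).

Lemma om_12_34E X Y : om_12_34 X Y = dot (X *m J12_34) Y.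
Proof.
elim/row4_ind: X => a b c d; elim/row4_ind: Y => x y z t.
by rewrite /om_12_34 /wedge !row4_idx !row4E; ring.
Qed.

Lemma om_14_23E X Y : om_14_23 X Y = dot (X *m J14_23) Y.
Proof.
elim/row4_ind: X => a b c d; elim/row4_ind: Y => x y z t.
by rewrite /om_14_23 /wedge !row4_idx !row4E; ring.
Qed.

Lemma sqr_J12_34 : J12_34 *m J12_34 = - 1%:M.
Proof.
apply: eq_mulmx_row; elim/row4_ind => a b c d.
by rewrite mulmxA mulmxN mulmx1 !row4E; congr row4; ring.
Qed.

Lemma sqr_J14_23 : J14_23 *m J14_23 = - 1%:M.
Proof.
apply: eq_mulmx_row; elim/row4_ind => a b c d.
by rewrite mulmxA mulmxN mulmx1 !row4E; congr row4; ring.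
Qed.

(** * Tactics reducing each claim to scalar identities *)

Ltac row4_coordinates :=
  intros; repeat match goal with
  | X : matrix _ _ _ |- _ => elim/row4_ind: X => ? ? ? ?
  end.

Ltac row4_field rules :=
  rewrite ?row4_0 ?(row4E, rules) ?row4_idx;
  first [by field | by congr row4; field].

Ltac prove_row4 rules := row4_coordinates; row4_field rules.

Ltac prove_bracket br := by rewrite /br /wedge !e_row4 !row4_idx;
  row4_field row4E.

Ltac prove_lie brE :=
  apply: lie_bracket_intro; prove_row4 brE.

Ltac prove_symplectic lie omE sqrJ brE :=
  split; [exact: lie | exact: dot_form_bilinear omE | |
          exact: dot_form_nondegenerate omE sqrJ |];
  intros; rewrite !omE; prove_row4 brE.

Ltac prove_nabla lie brE :=
  apply: nabla_unique; [exact: lie | exact: dot_inner_product |];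
  rewrite /koszul; prove_row4 brE.

(** The equation is tested on an arbitrary row vector; reassociating to the left leaves only
    products of a row with an explicit matrix. *)
Ltac prove_mx_equation :=
  apply: eq_mulmx_row => ?; rewrite /complex_part /anticomplex_part tr_mx4;
  rewrite ?(mulmxDr, =^~scalemxAr, mulmxN, mulmxA, mul_mx_scalar, mulmx0);
  prove_row4 row4E.

Ltac prove_soliton omE sqrJ brE nablaE P0 Ric0 D0 :=
  apply: (scf_soliton_dot omE sqrJ (P := P0) (Ric := Ric0) (D := D0));
  [ intros; rewrite /chern_ricci_form trace_ad_mul /ad !trace_lin1_mx omE;
    rewrite ?mulmx0; prove_row4 brE
  | intros; rewrite /ricci_form trace_lin1_mx /curvature;
    prove_row4 (nablaE, brE)
  | intros ? ?; prove_row4 brE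
  | prove_mx_equation
  | prove_mx_equation ].

Definition diag4 a b c d : 'M[R]_4 :=
  mx4 (row4 a 0 0 0) (row4 0 b 0 0) (row4 0 0 c 0) (row4 0 0 0 d).

(** * The five brackets in coordinates, and their symplectic axioms *)

Lemma br_R4E a b c d x y z t :
  br_R4 (row4 a b c d) (row4 x y z t) = row4 0 0 0 0.
Proof. exact: row4_0. Qed.

Lemma br_rh3E a b c d x y z t :
  br_rh3 (row4 a b c d) (row4 x y z t) = row4 0 0 (a * y - b * x) 0.
Proof. prove_bracket br_rh3. Qed.

Lemma br_rr3m1E a b c d x y z t :
  br_rr3m1 (row4 a b c d) (row4 x y z t) =
  row4 0 (a * y - b * x) (c * x - a * z) 0.
Proof. prove_bracket br_rr3m1. Qed.

Lemma br_rr30'E a b c d x y z t :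
  br_rr30' (row4 a b c d) (row4 x y z t) =
  row4 0 (a * z - c * x) (b * x - a * y) 0.
Proof. prove_bracket br_rr30'. Qed.

Lemma br_n4E a b c d x y z t :
  br_n4 (row4 a b c d) (row4 x y z t) =
  row4 0 (d * x - a * t) (d * y - b * t) 0.
Proof. prove_bracket br_n4. Qed.

Lemma lie_R4 : lie_bracket (@br_R4 R).
Proof. prove_lie br_R4E. Qed.

Lemma lie_rh3 : lie_bracket (@br_rh3 R).
Proof. prove_lie br_rh3E. Qed.

Lemma lie_rr3m1 : lie_bracket (@br_rr3m1 R).
Proof. prove_lie br_rr3m1E. Qed.

Lemma lie_rr30' : lie_bracket (@br_rr30' R).
Proof. prove_lie br_rr30'E. Qed.

Lemma lie_n4 : lie_bracket (@br_n4 R).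
Proof. prove_lie br_n4E. Qed.

Lemma symplectic_R4 : symplectic_lie_algebra (@br_R4 R) (@om_12_34 R).
Proof. prove_symplectic lie_R4 om_12_34E sqr_J12_34 br_R4E. Qed.

Lemma symplectic_rh3 : symplectic_lie_algebra (@br_rh3 R) (@om_14_23 R).
Proof. prove_symplectic lie_rh3 om_14_23E sqr_J14_23 br_rh3E. Qed.

Lemma symplectic_rr3m1 : symplectic_lie_algebra (@br_rr3m1 R) (@om_14_23 R).
Proof. prove_symplectic lie_rr3m1 om_14_23E sqr_J14_23 br_rr3m1E. Qed.

Lemma symplectic_rr30' : symplectic_lie_algebra (@br_rr30' R) (@om_14_23 R).
Proof. prove_symplectic lie_rr30' om_14_23E sqr_J14_23 br_rr30'E. Qed.

Lemma symplectic_n4 : symplectic_lie_algebra (@br_n4 R) (@om_12_34 R).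
Proof. prove_symplectic lie_n4 om_12_34E sqr_J12_34 br_n4E. Qed.

(** * Levi-Civita connections in closed form, and flatness *)

Section LeviCivita.
Variables x1 x2 x3 x4 y1 y2 y3 y4 : R.
Local Notation X := (row4 x1 x2 x3 x4).
Local Notation Y := (row4 y1 y2 y3 y4).

Lemma nabla_R4 : nabla (@br_R4 R) dot X Y = row4 0 0 0 0.
Proof. prove_nabla lie_R4 br_R4E. Qed.

Lemma nabla_rh3 : nabla (@br_rh3 R) dot X Y =
  row4 ((x2 * y3 + x3 * y2) / 2) (- (x1 * y3 + x3 * y1) / 2)
       ((x1 * y2 - x2 * y1) / 2) 0.
Proof. prove_nabla lie_rh3 br_rh3E. Qed.

Lemma nabla_rr3m1 : nabla (@br_rr3m1 R) dot X Y =
  row4 (x2 * y2 - x3 * y3) (- (x2 * y1)) (x3 * y1) 0.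
Proof. prove_nabla lie_rr3m1 br_rr3m1E. Qed.

Lemma nabla_rr30' : nabla (@br_rr30' R) dot X Y =
  row4 0 (x1 * y3) (- (x1 * y2)) 0.
Proof. prove_nabla lie_rr30' br_rr30'E. Qed.

Lemma nabla_n4 : nabla (@br_n4 R) dot X Y =
  row4 (- (x2 * y4 + x4 * y2) / 2)
       ((x4 * y1 - x1 * y4 - x3 * y4 - x4 * y3) / 2)
       ((x4 * y2 - x2 * y4) / 2)
       ((x1 * y2 + x2 * y1 + x2 * y3 + x3 * y2) / 2).
Proof. prove_nabla lie_n4 br_n4E. Qed.

End LeviCivita.

Lemma flat_R4 : flat (@br_R4 R) dot.
Proof. intros X Y Z; rewrite /curvature; prove_row4 (nabla_R4, br_R4E). Qed.

(** The connection along X is x_1 times the single operator ad e_1, so the covariant derivatives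
    commute; brackets have zero first coordinate, so the last curvature term vanishes too. *)
Lemma flat_rr30' : flat (@br_rr30' R) dot.
Proof.
intros X Y Z; rewrite /curvature; prove_row4 (nabla_rr30', br_rr30'E).
Qed.

(** * The soliton data for each algebra *)

Lemma soliton_R4 : scf_soliton_const (@br_R4 R) (@om_12_34 R) dot 0.
Proof.
prove_soliton om_12_34E sqr_J12_34 br_R4E nabla_R4
  (diag4 0 0 0 0) (diag4 0 0 0 0) (diag4 0 0 0 0).
Qed.

Lemma soliton_rh3 : scf_soliton_const (@br_rh3 R) (@om_14_23 R) dot (- (5 / 4)).
Proof.
(* With P = 0 and D diagonal, the second equation forces D = Ric^ac - cI, and the first follows
   since Ric^ac anticommutes with J. Here Ric^ac = diag(-1/4, -1/2, 1/2, 1/4); the bracket [e_1,e_2]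
   = e_3 requires d_1 + d_2 = d_3, whence c = -5/4. *)
prove_soliton om_14_23E sqr_J14_23 br_rh3E nabla_rh3
  (diag4 0 0 0 0) (diag4 (- 2^-1) (- 2^-1) 2^-1 0)
  (diag4 1 (3 / 4) (7 / 4) (3 / 2)).
Qed.

Lemma soliton_rr3m1 : scf_soliton_const (@br_rr3m1 R) (@om_14_23 R) dot (- 1).
Proof.
(* Again D = Ric^ac - cI, now with Ric^ac = diag(-1, 0, 0, 1); [e_1,e_2] = e_2 requires d_1 = 0,
   whence c = -1. *)
prove_soliton om_14_23E sqr_J14_23 br_rr3m1E nabla_rr3m1
  (diag4 0 0 0 0) (diag4 (- 2) 0 0 0) (diag4 0 1 1 2).
Qed.

Lemma soliton_rr30' : scf_soliton_const (@br_rr30' R) (@om_14_23 R) dot 0.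
Proof.
prove_soliton om_14_23E sqr_J14_23 br_rr30'E nabla_rr30'
  (diag4 0 0 0 0) (diag4 0 0 0 0) (diag4 0 0 0 0).
Qed.

Lemma soliton_n4 : scf_soliton_const (@br_n4 R) (@om_12_34 R) dot (- (5 / 4)).
Proof.
(* Here -JP^tJ = P, hence P^c = (P + P^t)/2, and D = Ric^ac - cI + P solves both equations. With
   Ric^ac = diag(-1/4, 1/4, 3/4, -3/4), the bracket [e_4,e_1] = e_2 requires d_4 + d_1 = d_2, whence
   c = -5/4. *)
prove_soliton om_12_34E sqr_J12_34 br_n4E nabla_n4
  (mx4 (row4 0 0 (- 2^-1) 0) (row4 0 0 0 0)
       (row4 0 0 0 0) (row4 0 (- 2^-1) 0 0))
  (diag4 (- 2^-1) 0 2^-1 (- 1))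
  (mx4 (row4 1 0 (- 2^-1) 0) (row4 0 (3 / 2) 0 0)
       (row4 0 0 2 0) (row4 0 (- 2^-1) 0 2^-1)).
Qed.

End Dimension4.

Theorem mainTheorem3 (R : realType) :
  (symplectic_lie_algebra (@br_R4 R) (@om_12_34 R) /\
   exists g, almost_kaehler (@om_12_34 R) g /\ flat (@br_R4 R) g /\
     steady_scf_soliton (@br_R4 R) (@om_12_34 R) g) /\
  (symplectic_lie_algebra (@br_rh3 R) (@om_14_23 R) /\
   exists g, almost_kaehler (@om_14_23 R) g /\
     expanding_scf_soliton (@br_rh3 R) (@om_14_23 R) g) /\
  (symplectic_lie_algebra (@br_rr3m1 R) (@om_14_23 R) /\
   exists g, almost_kaehler (@om_14_23 R) g /\
     expanding_scf_soliton (@br_rr3m1 R) (@om_14_23 R) g) /\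
  (symplectic_lie_algebra (@br_rr30' R) (@om_14_23 R) /\
   exists g, almost_kaehler (@om_14_23 R) g /\ flat (@br_rr30' R) g /\
     steady_scf_soliton (@br_rr30' R) (@om_14_23 R) g) /\
  (symplectic_lie_algebra (@br_n4 R) (@om_12_34 R) /\
   exists g, almost_kaehler (@om_12_34 R) g /\
     expanding_scf_soliton (@br_n4 R) (@om_12_34 R) g).
Proof.
(* Compatibility involves the form and the metric but no bracket, so two almost-Kähler structures
   serve all five algebras. *)
have ak12 := almost_kaehler_dot (@om_12_34E R) (@sqr_J12_34 R).
have ak14 := almost_kaehler_dot (@om_14_23E R) (@sqr_J14_23 R).
have c54 : - (5 / 4) < 0 :> R by rewrite oppr_lt0 divr_gt0 ?ltr0n.
split; [|split; [|split; [|split]]]; split.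
- exact: symplectic_R4.
- by exists dot; split; [|split; [exact: flat_R4 | exact: soliton_R4]].
- exact: symplectic_rh3.
- by exists dot; split=> //; exists (- (5 / 4)); split=> //; exact: soliton_rh3.
- exact: symplectic_rr3m1.
- exists dot; split=> //; exists (- 1); rewrite oppr_lt0 ltr01; split=> //.
  exact: soliton_rr3m1.
- exact: symplectic_rr30'.
- by exists dot; split; [|split; [exact: flat_rr30' | exact: soliton_rr30']].
- exact: symplectic_n4.
- by exists dot; split=> //; exists (- (5 / 4)); split=> //; exact: soliton_n4.
Qed.
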